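(* Let $\mathbb{F}_q$ be a finite field with $q$ elements, let $n\ge 1$, let $w_0,\dots,w_n$ be positive integers, and let $X=\mathbb{P}(w_0,\dots,w_n)$ be the weighted projective space over $\overline{\mathbb{F}}_q$. Let $Y_Q=\{[t_0^{w_0}:\cdots:t_n^{w_n}] : t_i\in\mathbb{F}_q^*\}\subset X$. Put $d_i=\frac{q-1}{\gcd(q-1,w_i)}$ and $\alpha_i=d_iw_i$ for $i=1,\dots,n$, and $\alpha_I=\sum_{i\in I}\alpha_i$ for $I\subseteq[n]=\{1,\dots,n\}$. If $w_0\mid q-1$, then for every $\alpha$ in the numerical semigroup generated by $w_0,\dots,w_n$, $$H_{Y_Q}(\alpha)=\sum_{s=0}^{n}(-1)^s\sum_{I\subseteq[n],\,|I|=s}\dim_{\mathbb{F}_q}S_{\alpha-\alpha_I}.$$ Moreover, the $a$-invariant of $Y_Q$ is $$a_{Y_Q}=(d_1-1)w_1+\cdots+(d_n-1)w_n-w_0.$$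
   Context: Standing assumption on the weights: any $n$ of the integers $w_0,\dots,w_n$ have no common divisor greater than $1$. The weighted projective space is $\mathbb{P}(w_0,\dots,w_n)=(\overline{\mathbb{F}}_q^{\,n+1}\setminus\{0\})/G$ with $G=\{(\lambda^{w_0},\dots,\lambda^{w_n}):\lambda\in\overline{\mathbb{F}}_q^*\}$ acting by componentwise multiplication; $[p_0:\cdots:p_n]$ is the orbit of $(p_0,\dots,p_n)$. The ring $S=\mathbb{F}_q[x_0,\dots,x_n]$ is graded by $\deg x_i=w_i$; $S_\alpha$ is the $\mathbb{F}_q$-vector space spanned by the monomials of degree $\alpha$ (so $S_\alpha=0$ if there are none, in particular if $\alpha<0$). The semigroup generated by $w_0,\dots,w_n$ is taken to contain $0$. For a subset $Y$ of the $\mathbb{F}_q$-rational points of $X$, the vanishing ideal $I(Y)\subset S$ is the ideal generated by all homogeneous polynomials vanishing at every point of $Y$; $I_\alpha(Y)=I(Y)\cap S_\alpha$; and the Hilbert function is $H_Y(\alpha)=\dim_{\mathbb{F}_q}S_\alpha-\dim_{\mathbb{F}_q}I_\alpha(Y)$. The Hilbert series of $S/I(Y)$ can be written as $\sum_{\alpha}H_Y(\alpha)t^\alpha=\dfrac{p_{S/I(Y)}(t)}{(1-t^{w_0})\cdots(1-t^{w_n})}$ for a unique polynomial $p_{S/I(Y)}(t)$ with integer coefficients, and the $a$-invariant of $Y$ is $a_Y=\deg(p_{S/I(Y)}(t))-w_0-\cdots-w_n$. *)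

(* Defs.v *)
From HB Require Import structures.
From mathcomp Require Import all_boot all_order all_algebra.
From mathcomp Require Import boolp classical_sets.
From mathcomp Require Import mpoly.

Set Implicit Arguments.
Unset Strict Implicit.
Unset Printing Implicit Defensive.

Import Order.TTheory GRing.Theory Num.Theory.

Local Open Scope classical_set_scope.
Local Open Scope ring_scope.

Section LinearAlgebra.
Variables (F : fieldType) (L : lmodType F).

Definition is_basis (V : set L) (d : nat) (b : 'I_d -> L) : Prop :=
  (forall v, V v <-> exists c : 'I_d -> F, v = \sum_i c i *: b i) /\
  (forall c : 'I_d -> F, \sum_i c i *: b i = 0 -> forall i, c i = 0).

(* The ambient space may be infinite-dimensional, so \dim does not apply.
   The value is 0 when V is not a finite-dimensional subspace. *)
Definition dimension (V : set L) : nat :=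
  xget 0%N [set d | exists b : 'I_d -> L, is_basis V b].

End LinearAlgebra.

Definition ideal_gen (R : comNzRingType) (A : set R) : set R :=
  [set f | exists (k : nat) (g h : 'I_k -> R),
     (forall i, A (h i)) /\ f = \sum_i g i * h i].

Section Weights.
Variables (n : nat) (w : 'I_n.+1 -> nat).

Definition well_formed : Prop :=
  forall (i : 'I_n.+1) (d : nat), (forall j, j != i -> (d %| w j)%N) ->
    (d <= 1)%N.

Definition in_semigroup (a : nat) : Prop :=
  exists c : 'I_n.+1 -> nat, a = (\sum_i c i * w i)%N.

Definition wdeg (m : 'X_{1..n.+1}) : nat := (\sum_i w i * m i)%N.

End Weights.

Section WeightedProjectiveSpace.
Variables (n : nat) (w : 'I_n.+1 -> nat) (K : fieldType).

Definition worbit (p : {ffun 'I_n.+1 -> K}) : set {ffun 'I_n.+1 -> K} :=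
  [set p' | exists2 l : K, l != 0 & p' = [ffun i => l ^+ w i * p i]].

Record wproj := WProj {
  wproj_set : set {ffun 'I_n.+1 -> K};
  wproj_orbit : exists2 p, p != 0 & wproj_set = worbit p
}.

End WeightedProjectiveSpace.

Section Hilbert.
Variables (n : nat) (w : 'I_n.+1 -> nat) (F : fieldType).

Definition graded_part (a : int) : set {mpoly F[n.+1]} :=
  [set f | forall m, m \in msupp f -> (wdeg w m)%:Z = a].

Variables (K : fieldType) (iota : {rmorphism F -> K}).

(* All representatives p of the point P are tested; for homogeneous f this
   does not depend on the representative. *)
Definition vanishes_at (f : {mpoly F[n.+1]}) (P : wproj w K) : Prop :=
  forall p, wproj_set P p -> (map_mpoly iota f).@[p] = 0.

Definition vanishing_ideal (Y : set (wproj w K)) : set {mpoly F[n.+1]} :=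
  ideal_gen [set f | (exists a : int, graded_part a f) /\
                     (forall P, Y P -> vanishes_at f P)].

Definition hilbert_fun (Y : set (wproj w K)) (a : int) : int :=
  (dimension (graded_part a))%:Z
  - (dimension (vanishing_ideal Y `&` graded_part a))%:Z.

(* p(t) = (\prod_i (1 - t^(w i))) * \sum_(a >= 0) H_Y(a) t^a as formal power
   series, coefficient by coefficient; this determines p. *)
Definition is_hilbert_numerator (Y : set (wproj w K)) (p : {poly int}) : Prop :=
  forall k : nat, p`_k =
    \sum_(j < k.+1) (\prod_(i < n.+1) (1 - 'X^(w i)))`_j
                    * hilbert_fun Y (k - j)%N%:Z.

Definition hilbert_numerator (Y : set (wproj w K)) : {poly int} :=
  xget 0 [set p | is_hilbert_numerator Y p].

Definition a_invariant (Y : set (wproj w K)) : int :=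
  (size (hilbert_numerator Y)).-1%:Z - \sum_i (w i)%:Z.

Definition Y_Q : set (wproj w K) :=
  [set P | exists2 t : 'I_n.+1 -> F, (forall i, t i != 0)
         & wproj_set P = worbit w [ffun i => iota (t i ^+ w i)]].

End Hilbert.

Arguments graded_part {n} w F a _.
Arguments Y_Q {n} w {F K} iota _.

Section Degrees.
Variables (q n : nat) (w : 'I_n.+1 -> nat).

Definition dnum (i : 'I_n.+1) : nat := (q.-1 %/ gcdn q.-1 (w i))%N.

(* i : 'I_n stands for the index i + 1 in {1, ..., n}. *)
Definition alpha_set (I : {set 'I_n}) : nat :=
  (\sum_(i in I) dnum (lift ord0 i) * w (lift ord0 i))%N.

End Degrees.

(* Main.v *)
(* Put q = #|F|. Since w_0 | q - 1 | d_i w_i, the binomials x_i^{d_i} -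
   x_0^{d_i w_i / w_0}, i = 1, ..., n, are homogeneous and vanish on Y_Q.
   They rewrite every monomial to one of the same degree with m_i < d_i for
   i >= 1. Conversely, a homogeneous f supported on such reduced monomials
   and vanishing on Y_Q is zero: averaging f(t_0^{w_0}, ..., t_n^{w_n})
   against the character t^{-w m'} of the torus (F minus 0)^{n+1} isolates
   the coefficient of x^{m'}, because within one degree the characters of
   distinct reduced monomials differ. So H_{Y_Q}(k) counts the reduced
   monomials of degree k; inclusion-exclusion over the violated bounds m_i <
   d_i gives the formula, and summing it over k gives the Hilbert numerator
   \prod_{i >= 1} (1 - t^{d_i w_i}). *)

Require Import Defs.
From HB Require Import structures.
From mathcomp Require Import all_boot all_order all_algebra.
From mathcomp Require Import boolp classical_sets.
From mathcomp Require Import mpoly finfield.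

Set Implicit Arguments.
Unset Strict Implicit.
Unset Printing Implicit Defensive.

Import Order.TTheory GRing.Theory Num.Theory.

Local Open Scope classical_set_scope.
Local Open Scope ring_scope.

(** * Bases and the dimension of a set of vectors *)

Lemma is_basis_mem (F : fieldType) (L : lmodType F) (V : set L) (d : nat)
    (b : 'I_d -> L) (i : 'I_d) :
  is_basis V b -> V (b i).
Proof.
move=> [genb _]; apply/genb; exists (fun j => (i == j)%:R).
rewrite (bigD1 i) //= eqxx scale1r big1 ?addr0 // => j /negPf.
by rewrite eq_sym => ->; rewrite scale0r.
Qed.

(** Expressing each family in the other gives matrices A and B; freeness of [b] forces A B = 1, and
    [mulmx1_min] then compares the sizes. *)
Lemma is_basis_size_le (F : fieldType) (L : lmodType F) (V : set L) (d e : nat)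
    (b : 'I_d -> L) (b' : 'I_e -> L) :
  is_basis V b -> is_basis V b' -> (d <= e)%N.
Proof.
move=> basisb basisb'; have [genb freeb] := basisb; have [genb' _] := basisb'.
have /choice[A AE] i : exists c : 'I_e -> F, b i = \sum_j c j *: b' j.
  by apply/genb'; exact: is_basis_mem basisb.
have /choice[B BE] i : exists c : 'I_d -> F, b' i = \sum_j c j *: b j.
  by apply/genb; exact: is_basis_mem basisb'.
apply: (@mulmx1_min _ d e (\matrix_(i, j) A i j) (\matrix_(i, j) B i j)).
apply/matrixP=> i k; rewrite !mxE; apply/eqP; rewrite -subr_eq0; apply/eqP.
under eq_bigr do rewrite !mxE.
apply: (freeb (fun k => \sum_j A i j * B j k - (i == k)%:R)).
under eq_bigr do rewrite scalerBl scaler_suml.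
rewrite sumrB exchange_big /=.
under eq_bigr => j _ do
  (under eq_bigr do rewrite -scalerA; rewrite -scaler_sumr -BE).
rewrite -AE (bigD1 i) //= eqxx scale1r big1 ?addr0 ?subrr // => j /negPf.
by rewrite eq_sym => ->; rewrite scale0r.
Qed.

(** Allows bases indexed by a subset of a finite type, such as bounded monomials, by transport along
    [enum_val]; comparing sizes of bases makes the value of [xget] unique. *)
Lemma dimension_card (F : fieldType) (L : lmodType F) (V : set L)
    (T : finType) (P : pred T) (b : T -> L) :
  (forall v, V v <-> exists c : T -> F, v = \sum_(i | P i) c i *: b i) ->
  (forall c : T -> F, \sum_(i | P i) c i *: b i = 0 ->
     forall i, P i -> c i = 0) ->
  dimension V = #|[pred i | P i]|.
Proof.
move=> genP freeP; rewrite -[#|_|]/#|P|.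
have genV v : V v <-> exists c : T -> F, v = \sum_(i in P) c i *: b i.
  exact: genP.
have freeb (c : T -> F) :
  \sum_(i in P) c i *: b i = 0 -> forall i, i \in P -> c i = 0 by exact: freeP.
have ext (c : 'I_#|P| -> F) :
    exists c' : T -> F, forall i, c' (enum_val i) = c i.
  (* Outside [P] the index equals [#|P|], so [insub] fails and the extension is 0 there. *)
  exists (fun t => if insub (index t (enum P)) is Some i then c i else 0) => i.
  rewrite insubT.
    by rewrite [X in (_ < X)%N]cardE index_mem mem_enum enum_valP.
  move=> lti; congr (c _); apply/val_inj => /=.
  by rewrite [enum_val i](enum_val_nth (enum_val i)) index_uniq ?enum_uniq //
    -cardE.
have basisP : is_basis V (fun i : 'I_#|P| => b (enum_val i)).
  split=> [v|c c0 i].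
    split=> [/genV[c ->]|[c ->]].
      by exists (c \o enum_val); rewrite big_enum_val.
    have [c' c'E] := ext c; apply/genV; exists c'.
    by rewrite [RHS]big_enum_val; apply: eq_bigr => i _; rewrite c'E.
  have [c' c'E] := ext c; rewrite -c'E; apply: freeb; last exact: enum_valP.
  by rewrite big_enum_val -[RHS]c0; apply: eq_bigr => j _; rewrite c'E.
apply: xget_unique; first by exists (fun i : 'I_#|P| => b (enum_val i)).
move=> d [b' basisP']; apply/eqP; rewrite eqn_leq.
by rewrite (is_basis_size_le basisP' basisP) (is_basis_size_le basisP basisP').
Qed.

(** * Monomials of given weighted degree and inclusion-exclusion *)

Lemma wdegD (n : nat) (w : 'I_n.+1 -> nat) (m1 m2 : 'X_{1..n.+1}) :
  wdeg w (m1 + m2)%MM = (wdeg w m1 + wdeg w m2)%N.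
Proof. by rewrite -big_split; apply: eq_bigr => i _; rewrite mnmDE mulnDr. Qed.

Lemma mdeg_le_wdeg (n : nat) (w : 'I_n.+1 -> nat) (m : 'X_{1..n.+1}) :
  (forall i, (0 < w i)%N) -> (mdeg m <= wdeg w m)%N.
Proof. by move=> w_gt0; rewrite mdegE leq_sum // => i _; rewrite leq_pmull. Qed.

(** Positive weights bound the total degree by the weighted one, so finitely many monomials suffice.
    The condition [wdeg w m + s == k] avoids truncated subtraction, and the sum is empty for s >
    k. *)
Lemma graded_partE (n : nat) (w : 'I_n.+1 -> nat) (F : fieldType) (k s : nat)
    (f : {mpoly F[n.+1]}) :
  (forall i, (0 < w i)%N) -> graded_part w F (k%:Z - s%:Z) f ->
  f = \sum_(m : 'X_{1..n.+1 < k.+1} | (wdeg w m + s == k)%N) f@_m *: 'X_[m].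
Proof.
move=> w_gt0 homf.
have degf m : m \in msupp f -> (wdeg w m + s)%N = k.
  by move=> /homf /eqP; rewrite eq_sym subr_eq => /eqP[].
rewrite {1}(@mpolywE _ _ k.+1 f); last first.
  rewrite msizeE; apply/bigmax_leqP_seq => m /degf <- _; rewrite ltnS.
  by rewrite (leq_trans (mdeg_le_wdeg m w_gt0)) ?leq_addr.
rewrite [RHS]big_mkcond; apply: eq_bigr => m _; case: ifP => // /eqP degm.
by rewrite memN_msupp_eq0 ?scale0r //; apply/negP => /degf.
Qed.

Lemma mcoeff_bmonomials (n b : nat) (F : fieldType)
    (P : pred 'X_{1..n < b}) (c : 'X_{1..n < b} -> F) (m : 'X_{1..n < b}) :
  P m -> (\sum_(m' | P m') c m' *: 'X_[m'])@_m = c m.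
Proof.
move=> Pm; rewrite raddf_sum (bigD1 m) //= mcoeffZ mcoeffX eqxx mulr1.
rewrite big1 ?addr0 // => m' /andP[_ nm]; rewrite mcoeffZ mcoeffX -bmeqP.
by rewrite (negPf nm) mulr0.
Qed.

Lemma dimension_graded_part (n : nat) (w : 'I_n.+1 -> nat) (F : fieldType)
    (k s : nat) :
  (forall i, (0 < w i)%N) ->
  dimension (graded_part w F (k%:Z - s%:Z)) =
    #|[pred m : 'X_{1..n.+1 < k.+1} | (wdeg w m + s == k)%N]|.
Proof.
move=> w_gt0.
apply: (dimension_card (b := fun m : 'X_{1..n.+1 < k.+1} => 'X_[F, m])).
  move=> f; split=> [homf|[c ->] m].
    by exists (fun m : 'X_{1..n.+1 < k.+1} => f@_m); apply: (graded_partE w_gt0).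
  rewrite mcoeff_msupp => /eqP nz; apply/eqP; rewrite eq_sym subr_eq.
  apply/eqP; congr Posz; apply/eqP; apply: contra_notT nz => degm.
  rewrite raddf_sum big1 // => m' /= /eqP degm'; rewrite mcoeffZ mcoeffX.
  have [mE|_] := eqVneq (bmnm m') m; last by rewrite mulr0.
  by move: degm; rewrite -mE degm' eqxx.
move=> c c0 m degm; have := congr1 (mcoeff m) c0; rewrite mcoeff0 => <-.
by rewrite (mcoeff_bmonomials c degm).
Qed.

(** Multiplication by x^u is a bijection onto the monomials of degree k - s divisible by x^u. *)
Lemma card_shift_monomials (n : nat) (w : 'I_n.+1 -> nat) (k s : nat)
    (u : 'X_{1..n.+1}) :
  (forall i, (0 < w i)%N) ->
  #|[pred m : 'X_{1..n.+1 < k.+1} | (wdeg w m + (s + wdeg w u) == k)%N]| =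
  #|[pred m : 'X_{1..n.+1 < k.+1} | (wdeg w m + s == k)%N && (u <= m)%MM]|.
Proof.
move=> w_gt0; rewrite -!sum1_card.
have bound m : (wdeg w m + s == k)%N -> (mdeg m < k.+1)%N.
  by move=> /eqP <-; rewrite ltnS (leq_trans (mdeg_le_wdeg m w_gt0)) ?leq_addr.
(* The defaults of [insubd] do no harm: [up] is used only where the degree bound holds, and [down]
   never raises an exponent. *)
pose up (m : 'X_{1..n.+1 < k.+1}) : 'X_{1..n.+1 < k.+1} := insubd m (m + u)%MM.
pose down (m : 'X_{1..n.+1 < k.+1}) : 'X_{1..n.+1 < k.+1} := insubd m (m - u)%MM.
have downE m : val (down m) = (m - u)%MM.
  rewrite val_insubd; case: ifP => // /negP[]; apply: leq_ltn_trans (bmdeg m).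
  by rewrite !mdegE leq_sum // => i _; rewrite mnmBE leq_subr.
have upE (m : 'X_{1..n.+1 < k.+1}) :
    (wdeg w m + (s + wdeg w u) == k)%N -> val (up m) = (m + u)%MM.
  move=> degm; rewrite val_insubd bound //.
  by rewrite wdegD -addnA [(wdeg w u + s)%N]addnC.
rewrite (reindex_onto down up) /=; last first.
  by move=> m degm; apply/val_inj; rewrite downE (upE m degm) addmK.
apply: eq_bigl => m; rewrite !inE; apply/andP/andP.
  move=> [degm /eqP <-]; rewrite (upE _ degm); split; last exact: lem_addl.
  by rewrite wdegD -addnA [(wdeg w u + s)%N]addnC.
move=> [degm le_um].
have degd : (wdeg w (down m) + (s + wdeg w u) == k)%N.
  by rewrite downE (addnC s) addnA -wdegD submK.
by split=> //; apply/eqP/val_inj; rewrite (upE _ degd) downE submK.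
Qed.

(** The A-term counts the monomials that violate every bound in A. For a single monomial the signed
    sum over A factors as a product over j of 1 minus the indicator of violation. *)
Lemma inclusion_exclusion_monomials (n : nat) (w : 'I_n.+1 -> nat)
    (J : finType) (phi : J -> 'I_n.+1) (e : J -> nat) (k s : nat) :
  (forall i, (0 < w i)%N) -> injective phi ->
  \sum_(A : {set J}) (-1) ^+ #|A| *
    #|[pred m : 'X_{1..n.+1 < k.+1} |
        (wdeg w m + (s + \sum_(j in A) e j * w (phi j)) == k)%N]|%:Z =
  #|[pred m : 'X_{1..n.+1 < k.+1} |
        (wdeg w m + s == k)%N && [forall j, (m (phi j) < e j)%N]]|%:Z.
Proof.
move=> w_gt0 inj_phi.
have cardE (A : {set J}) :
  (#|[pred m : 'X_{1..n.+1 < k.+1} |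
        (wdeg w m + (s + \sum_(j in A) e j * w (phi j)) == k)%N]|%:Z =
  \sum_(m : 'X_{1..n.+1 < k.+1} | (wdeg w m + s == k)%N)
     \prod_(j in A) (e j <= m (phi j))%N%:R).
  pose u : 'X_{1..n.+1} := (\sum_(j in A) U_(phi j) *+ e j)%MM.
  have uE i : u i = (\sum_(j in A) e j * (phi j == i))%N.
    rewrite mnm_sumE; apply: eq_bigr => j _.
    by rewrite mulmnE mnm1E mulnC.
  have -> : (\sum_(j in A) e j * w (phi j))%N = wdeg w u.
    rewrite /wdeg; under [RHS]eq_bigr do rewrite uE big_distrr /=.
    rewrite exchange_big; apply: eq_bigr => j _ /=.
    rewrite (bigD1 (phi j)) //= eqxx muln1 mulnC big1 ?addn0 // => i /negPf.
    by rewrite eq_sym => ->; rewrite !muln0.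
  rewrite card_shift_monomials // -sum1_card -natz natr_sum big_mkcondr /=.
  apply: eq_bigr => m _.
  (* Since [phi] is injective, the exponent of [u] at [phi j] is exactly [e j] for j in A, and it is
     0 elsewhere. *)
  have -> : (u <= m)%MM = [forall (j | j \in A), (e j <= m (phi j))%N].
    apply/mnm_lepP/forall_inP => le_um.
      move=> j Aj; apply: leq_trans (le_um _); rewrite uE (bigD1 j) //= eqxx.
      by rewrite muln1 leq_addr.
    move=> i; rewrite uE.
    have [j /andP[Aj /eqP <-]|noj] := pickP [pred j | (j \in A) && (phi j == i)].
      rewrite (bigD1 j) //= eqxx muln1 big1 ?addn0 ?le_um // => j' /andP[_ nj].
      by rewrite (inj_eq inj_phi) (negPf nj) muln0.
    rewrite big1 // => j Aj; move: (noj j); rewrite /= Aj /= => ->.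
    by rewrite muln0.
  case: forall_inP => [le_em|/forall_inP].
    by rewrite big1 // => j Aj; rewrite le_em.
  rewrite negb_forall => /existsP[j]; rewrite negb_imply => /andP[Aj /negPf nle].
  by rewrite (bigD1 j) //= nle mul0r.
under eq_bigr do rewrite cardE mulr_sumr.
rewrite exchange_big -sum1_card -natz natr_sum big_mkcondr /=.
apply: eq_bigr => m _.
transitivity (\prod_j (- (e j <= m (phi j))%N%:R + 1 : int)).
  rewrite bigA_distr; apply: eq_big => [A|A _]; first by rewrite inE.
  rewrite -big_mkcond /= prodrN; congr (_ * _).
case: forallP => [lt_me|/forallP].
  by rewrite big1 // => j _; rewrite leqNgt lt_me oppr0 add0r.
rewrite negb_forall => /existsP[j]; rewrite -leqNgt => le_em.
by rewrite (bigD1 j) //= le_em addNr mul0r.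
Qed.

Lemma prodr_1BXn (R : comNzRingType) (J : finType) (a : J -> nat) :
  \prod_j (1 - 'X^(a j) : {poly R}) =
  \sum_(A : {set J}) (-1) ^+ #|A| *: 'X^(\sum_(j in A) a j)%N.
Proof.
under eq_bigr do rewrite addrC.
rewrite bigA_distr; apply: eq_big => [A|A _]; first by rewrite inE.
rewrite -big_mkcond /= prodrN -mul_polyC rmorphXn rmorphN rmorph1 /=.
by rewrite prodrXr.
Qed.

(** * Exponents modulo q - 1 and character sums *)

(** After division by the gcd the two factors are coprime. For Q = q - 1 and v = w_i this makes d_i
    the least positive x with q - 1 dividing w_i x. *)
Lemma dvdn_gcd_mul (Q v x : nat) : (0 < Q)%N ->
  (Q %| v * x)%N = (Q %/ gcdn Q v %| x)%N.
Proof.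
move=> Q_gt0; have g_gt0 : (0 < gcdn Q v)%N by rewrite gcdn_gt0 Q_gt0.
set g := gcdn Q v in g_gt0 *.
have [gQ gv] : Q = (Q %/ g * g)%N /\ v = (v %/ g * g)%N.
  by rewrite !divnK ?dvdn_gcdl ?dvdn_gcdr.
rewrite {1}gQ {1}gv mulnAC dvdn_pmul2r // Gauss_dvdr //.
by rewrite /coprime -(eqn_pmul2r g_gt0) mul1n muln_gcdl -gQ -gv.
Qed.

(** Ensures that exponents below d_i give distinct characters t^(w_i m_i). *)
Lemma eq_of_modn_mul (Q v x y : nat) : (0 < Q)%N ->
  (x < Q %/ gcdn Q v)%N -> (y < Q %/ gcdn Q v)%N ->
  v * x == v * y %[mod Q] -> x = y.
Proof.
move=> Q_gt0; wlog le_yx : x y / (y <= x)%N => [hwlog ltx lty eqm|].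
  have [le_yx|/ltnW le_xy] := leqP y x; first exact: hwlog.
  by apply/esym/hwlog; rewrite // eq_sym.
move=> ltx _; rewrite eqn_mod_dvd ?leq_mul2l ?le_yx ?orbT // -mulnBr.
rewrite dvdn_gcd_mul // => dvd_xy; apply/eqP; rewrite eqn_leq le_yx andbT.
rewrite -subn_eq0; apply: contraLR ltx; rewrite -lt0n -leqNgt => /dvdn_leq.
by move=> /(_ _ dvd_xy) /leq_trans; apply; rewrite leq_subr.
Qed.

Lemma card_finField_pred_gt0 (F : finFieldType) : (0 < #|F|.-1)%N.
Proof. by rewrite -subn1 subn_gt0 finNzRing_gt1. Qed.

Lemma expf_modn_pred (F : finFieldType) (x : F) (a : nat) : x != 0 ->
  x ^+ (a %% #|F|.-1) = x ^+ a.
Proof.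
move=> x0; apply: expr_mod; apply: (mulfI x0).
by rewrite -exprS prednK ?expf_card ?mulr1 // ltnW // finNzRing_gt1.
Qed.

(** Orthogonality of the characters of the unit group; the value -1 is the number q - 1 of units,
    read in [F]. *)
Lemma sum_units_expf (F : finFieldType) (a b : nat) :
  \sum_(x : F | x != 0) x ^+ a / x ^+ b =
  if a == b %[mod #|F|.-1] then -1 else 0.
Proof.
have card0F : #|F|%:R = 0 :> F.
  (* Translation by 1 permutes [F], so adding 1 to each summand leaves the sum of all elements
     unchanged. *)
  apply: (addrI (\sum_(x : F) x)); rewrite addr0 -[_%:R]sumr_const -big_split.
  by rewrite [RHS](reindex_inj (addIr 1)).
case: ifP => [eq_ab|/negbT ne_ab].
  rewrite (eq_bigr (fun=> 1)) => [|x x0].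
    rewrite sumr_const -[#|_|]/#|predC1 (0 : F)| cardC1.
    apply/eqP; rewrite -subr_eq0 opprK -mulrSr prednK ?card0F //.
    by rewrite ltnW // finNzRing_gt1.
  by rewrite -(expf_modn_pred a) // (eqP eq_ab) expf_modn_pred // divff ?expf_neq0.
have Q_gt0 := card_finField_pred_gt0 F.
(* Reducing the exponents keeps [size p] at most q - 1, so the nonzero [p] cannot vanish at all q -
   1 units. *)
pose p : {poly F} := 'X^(a %% #|F|.-1) - 'X^(b %% #|F|.-1).
have [u u0 neq_u] : exists2 u : F, u != 0 & u ^+ a != u ^+ b.
  apply/exists_inP; apply: contraT; rewrite negb_exists_in => /forall_inP eq_u.
  have p0 : p != 0.
    apply: contraNneq ne_ab => /(congr1 (coefp (a %% #|F|.-1))).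
    rewrite /= coefB !coefXn eqxx coef0; case: eqP => // _ /eqP.
    by rewrite subr0 oner_eq0.
  have := max_poly_roots p0 (rs := enum (predC1 (0 : F))).
  rewrite enum_uniq -cardE cardC1 => /(_ _ isT) lt_size.
  have : (size p <= #|F|.-1)%N.
    by rewrite (leq_trans (size_polyD _ _)) // size_polyN !size_polyXn
      geq_max !ltn_pmod.
  rewrite leqNgt lt_size //; apply/allP => x; rewrite mem_enum => x0.
  rewrite rootE !hornerE !expf_modn_pred // subr_eq0.
  by move: (eq_u _ x0); rewrite negbK.
(* Substituting u x for x multiplies the sum by u^a / u^b, which differs from 1. *)
pose S := \sum_(x : F | x != 0) x ^+ a / x ^+ b.
have S_inv : S = u ^+ a / u ^+ b * S.
  rewrite {1}/S (reindex_inj (mulfI u0)) /S big_distrr /=.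
  apply: eq_big => [x|x _]; first by rewrite mulf_eq0 negb_or u0.
  by rewrite !exprMn invfM mulrACA.
apply/eqP; move: S_inv => /eqP; rewrite -subr_eq0 -{1}[S]mul1r -mulrBl mulf_eq0.
case/orP => //; rewrite subr_eq0 => /eqP eq1; case/eqP: neq_u.
by apply/esym; rewrite -[LHS]mul1r eq1 divfK ?expf_neq0.
Qed.

Lemma vanishing_reduced_eq0 (F : finFieldType) (n : nat) (w : 'I_n.+1 -> nat)
    (k : nat) (f : {mpoly F[n.+1]}) :
  (0 < w ord0)%N -> graded_part w F k%:Z f ->
  (forall m, m \in msupp f -> forall i : 'I_n,
     (m (lift ord0 i) < dnum #|F| w (lift ord0 i))%N) ->
  (forall t : 'I_n.+1 -> F, (forall i, t i != 0) ->
     f.@[fun i => t i ^+ w i] = 0) ->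
  f = 0.
Proof.
move=> w0_gt0 homf redf vanf; apply/mpolyP => m'; rewrite mcoeff0.
have [m'f|/memN_msupp_eq0//] := boolP (m' \in msupp f).
(* The common degree determines the exponent of x_0 from the others, as w_0 > 0. *)
have eq_m m : m \in msupp f ->
    (forall i : 'I_n, m (lift ord0 i) = m' (lift ord0 i)) -> m = m'.
  move=> mf eq_lift; have := homf _ mf; rewrite -(homf _ m'f) => -[].
  rewrite /wdeg !big_ord_recl; under eq_bigr do rewrite eq_lift.
  move=> /addIn /eqP; rewrite eqn_pmul2l // => /eqP eq0.
  by apply/mnmP => i; case: (unliftP ord0 i) => [j|] ->.
have: \sum_(t in ffun_on [pred x : F | x != 0])
    f.@[fun i => t i ^+ w i] / \prod_i t i ^+ (w i * m' i) = 0.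
  rewrite big1 // => t /ffun_onP t0.
  by rewrite vanf ?mul0r.
under eq_bigr do rewrite mevalE mulr_suml.
rewrite exchange_big /=.
under eq_bigr => m _.
  under eq_bigr => t _.
    rewrite -mulrA -prodf_div.
    under eq_bigr do rewrite -exprM.
    over.
  rewrite -big_distrr
    -(bigA_distr_big _ (fun i x => x ^+ (w i * m i) / x ^+ (w i * m' i))) /=.
  under eq_bigr do rewrite sum_units_expf.
  over.
(* The term of [m'] is its coefficient times (-1)^(n+1), one -1 per coordinate of the torus; all
   other terms must vanish. *)
rewrite (bigD1_seq m') ?msupp_uniq //= [X in _ + X]big1_seq ?addr0.
  under eq_bigr do rewrite eqxx.
  rewrite prodr_const => /eqP; rewrite mulf_eq0 expf_eq0 oppr_eq0 oner_eq0.
  by rewrite andbF orbF => /eqP.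
move=> m /andP[ne_m mf].
have [i ne_i] : exists i : 'I_n, m (lift ord0 i) != m' (lift ord0 i).
  apply/existsP; apply: contraNT ne_m; rewrite negb_exists => /forallP eq_lift.
  by apply/eqP/eq_m => // i; apply/eqP; rewrite -[_ == _]negbK.
(* One vanishing character sum kills the product: at index [i] the bound d_i keeps the two exponents
   incongruent modulo q - 1. *)
rewrite (bigD1 (lift ord0 i)) //= ifN ?mul0r ?mulr0 //.
apply: contraNN ne_i => /eq_of_modn_mul -> //; try exact: redf.
exact: card_finField_pred_gt0.
Qed.

(** * Evaluation on orbits and the vanishing ideal of [Y_Q] *)

Lemma graded_partP (n : nat) (w : 'I_n.+1 -> nat) (F : fieldType) (a : int)
    (f : {mpoly F[n.+1]}) :
  graded_part w F a f <-> forall m, (wdeg w m)%:Z <> a -> f@_m = 0.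
Proof.
split=> [homf m ne_a|homf m]; first by apply: memN_msupp_eq0; apply/negP => /homf.
by rewrite mcoeff_msupp; apply: contra_neqP => /homf.
Qed.

Lemma meval_map_mpolyE (F K : fieldType) (iota : {rmorphism F -> K}) (n : nat)
    (f : {mpoly F[n]}) (v : 'I_n -> K) :
  (map_mpoly iota f).@[v] =
  \sum_(m <- msupp f) iota f@_m * \prod_i v i ^+ m i.
Proof.
rewrite {1}[f]mpolyE (raddf_sum (map_mpoly iota)) (raddf_sum (meval v)).
by apply: eq_bigr => m _; rewrite /= map_mpolyZ map_mpolyX mevalZ mevalX.
Qed.

Lemma meval_map_mpoly (F K : fieldType) (iota : {rmorphism F -> K}) (n : nat)
    (f : {mpoly F[n]}) (v : 'I_n -> F) :
  (map_mpoly iota f).@[fun i => iota (v i)] = iota f.@[v].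
Proof.
rewrite meval_map_mpolyE mevalE rmorph_sum; apply: eq_bigr => m _.
rewrite rmorphM rmorph_prod; congr (_ * _).
by apply: eq_bigr => i _; rewrite rmorphXn.
Qed.

(** Reduces vanishing at a point of [Y_Q] to vanishing at its one representative with coordinates in
    [F]. *)
Lemma meval_map_mpoly_orbit (F K : fieldType) (iota : {rmorphism F -> K})
    (n : nat) (w : 'I_n.+1 -> nat) (k : nat) (f : {mpoly F[n.+1]}) (l : K)
    (v : 'I_n.+1 -> F) :
  graded_part w F k%:Z f ->
  (map_mpoly iota f).@[fun i => l ^+ w i * iota (v i)] = l ^+ k * iota f.@[v].
Proof.
move=> homf; rewrite meval_map_mpolyE mevalE rmorph_sum mulr_sumr.
rewrite big_seq [RHS]big_seq; apply: eq_bigr => m /homf [<-].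
rewrite rmorphM rmorph_prod mulrCA; congr (_ * _).
rewrite /wdeg -prodrXr -big_split; apply: eq_bigr => i _ /=.
by rewrite exprMn exprM rmorphXn.
Qed.

(** A homogeneous [f] with these zeros is itself a generator. Conversely, evaluation at a torus
    point kills every generator, hence every combination, whatever the degrees of the generators. *)
Lemma vanishing_ideal_Y_Q_graded (F K : fieldType) (iota : {rmorphism F -> K})
    (n : nat) (w : 'I_n.+1 -> nat) (k : nat) (f : {mpoly F[n.+1]}) :
  (vanishing_ideal iota (Y_Q w iota) `&` graded_part w F k%:Z) f <->
  graded_part w F k%:Z f /\
  forall t : 'I_n.+1 -> F, (forall i, t i != 0) ->
    f.@[fun i => t i ^+ w i] = 0.
Proof.
split=> [[[s [g [h [vanh ->]]]] homf]|[homf vanf]]; last first.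
  split=> //; exists 1%N, (fun=> 1), (fun=> f); split; last first.
    by rewrite big_ord1 mul1r.
  move=> _; split; first by exists k%:Z.
  move=> P [t t0 PE] p; rewrite PE => -[l l0 ->].
  rewrite -(rmorph0 iota) -(vanf t t0) -[LHS]mulr1.
  rewrite (meval_eq (v2 := fun i => l ^+ w i * iota (t i ^+ w i))) => [|i].
    by rewrite (meval_map_mpoly_orbit _ _ _ homf) vanf // rmorph0 mulr0 mul0r.
  by rewrite !ffunE.
split=> // t t0.
pose p : {ffun 'I_n.+1 -> K} := [ffun i => iota (t i ^+ w i)].
have p0 : p != 0.
  apply/eqP => /(congr1 (fun p : {ffun _} => p ord0)); rewrite !ffunE => /eqP.
  by rewrite fmorph_eq0 expf_eq0 (negPf (t0 _)) andbF.
have orbP : exists2 p', p' != 0 & worbit w p = worbit w p' by exists p.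
rewrite raddf_sum big1 // => i _ /=; rewrite mevalM.
have [_ /(_ (WProj orbP))] := vanh i.
move=> /(_ _ p) van_hi; apply/eqP; rewrite mulf_eq0; apply/orP; right.
rewrite -(fmorph_eq0 iota) -meval_map_mpoly; apply/eqP; rewrite -[RHS]van_hi.
- by apply: meval_eq => j; rewrite ffunE.
- by exists t.
by exists 1; rewrite ?oner_neq0 //; apply/ffunP => j; rewrite !ffunE expr1n mul1r.
Qed.

(** * Reduction of monomials and a basis of the graded vanishing ideal *)

Definition reduced (n : nat) (d : 'I_n.+1 -> nat) (m : 'X_{1..n.+1}) : bool :=
  [forall j : 'I_n, (m (lift ord0 j) < d (lift ord0 j))%N].

(* The normal form of [m] modulo the binomials
   [x_i ^ d_i - x_0 ^ (d_i * w_i / w_0)], [i >= 1]. *)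
Definition reduce_mnm (n : nat) (w d : 'I_n.+1 -> nat) (m : 'X_{1..n.+1}) :
    'X_{1..n.+1} :=
  [multinom if i == ord0
     then (m ord0 + \sum_(j < n) m (lift ord0 j) %/ d (lift ord0 j) *
             (d (lift ord0 j) * w (lift ord0 j) %/ w ord0))%N
     else (m i %% d i)%N | i < n.+1].

Lemma reduced_reduce_mnm (n : nat) (w d : 'I_n.+1 -> nat) (m : 'X_{1..n.+1}) :
  (forall i, (0 < d i)%N) -> reduced d (reduce_mnm w d m).
Proof. by move=> d_gt0; apply/forallP => j; rewrite mnmE ltn_pmod. Qed.

Lemma reduce_mnm0 (n : nat) (w d : 'I_n.+1 -> nat) (m : 'X_{1..n.+1}) :
  (forall j : 'I_n, (w ord0 %| d (lift ord0 j) * w (lift ord0 j))%N) ->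
  (w ord0 * reduce_mnm w d m ord0 =
     w ord0 * m ord0 + \sum_(j < n) m (lift ord0 j) %/ d (lift ord0 j) *
       (d (lift ord0 j) * w (lift ord0 j)))%N.
Proof.
move=> dvd_w0; rewrite mnmE mulnDr big_distrr; congr addn; apply: eq_bigr => j _.
by rewrite /= [LHS]mulnCA [(w ord0 * _)%N]mulnC divnK.
Qed.

(** Each factor x_j^(d_j) removed is replaced by a power of x_0 of the same weighted degree;
    divisibility by w_0 makes that power exact. *)
Lemma wdeg_reduce_mnm (n : nat) (w d : 'I_n.+1 -> nat) (m : 'X_{1..n.+1}) :
  (forall j : 'I_n, (w ord0 %| d (lift ord0 j) * w (lift ord0 j))%N) ->
  wdeg w (reduce_mnm w d m) = wdeg w m.
Proof.
move=> dvd_w0; rewrite /wdeg !big_ord_recl reduce_mnm0 // -addnA -big_split.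
congr addn; apply: eq_bigr => j _ /=; rewrite mnmE /=.
rewrite [in RHS](divn_eq (m _) (d (lift ord0 j))) mulnDr; congr addn.
by rewrite [RHS]mulnCA [(w _ * _)%N]mulnC.
Qed.

(** At each coordinate the exponents of t_i before and after reduction differ by a multiple of q -
    1. *)
Lemma meval_reduce_mnm (F : finFieldType) (n : nat) (w d : 'I_n.+1 -> nat)
    (m : 'X_{1..n.+1}) (t : 'I_n.+1 -> F) :
  (forall j : 'I_n, (w ord0 %| d (lift ord0 j) * w (lift ord0 j))%N) ->
  (forall j : 'I_n, (#|F|.-1 %| d (lift ord0 j) * w (lift ord0 j))%N) ->
  (forall i, t i != 0) ->
  'X_[F, reduce_mnm w d m].@[fun i => t i ^+ w i] =
  'X_[F, m].@[fun i => t i ^+ w i].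
Proof.
move=> dvd_w0 dvd_q t0; rewrite !mevalX; apply: eq_bigr => i _.
rewrite -!exprM -(expf_modn_pred (w i * m i)) // -(expf_modn_pred (_ * _)) //.
congr (_ ^+ _); case: (unliftP ord0 i) => [j|] ->.
  rewrite mnmE /= [in RHS](divn_eq (m _) (d (lift ord0 j))) mulnDr -modnDml.
  set s := (w _ * (_ * d _))%N; have /eqP -> : (#|F|.-1 %| s)%N.
    by rewrite /s mulnCA [(w _ * _)%N]mulnC dvdn_mull.
  by rewrite add0n.
rewrite reduce_mnm0 // -modnDmr; set s := (\sum_(j < n) _)%N.
have /eqP -> : (#|F|.-1 %| s)%N by apply: dvdn_sum => j _; apply: dvdn_mull.
by rewrite addn0.
Qed.

(** Triangularity: the tails are reduced, so a non-reduced monomial occurs only as the leading term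
    of its own binomial. *)
Lemma mcoeff_reduction_binomials (n : nat) (w d : 'I_n.+1 -> nat) (F : fieldType)
    (b : nat) (P : pred 'X_{1..n.+1 < b}) (c : 'X_{1..n.+1 < b} -> F)
    (m : 'X_{1..n.+1 < b}) :
  (forall i, (0 < d i)%N) -> P m -> ~~ reduced d m ->
  (\sum_(m' | P m') c m' *: ('X_[m'] - 'X_[reduce_mnm w d m']))@_m = c m.
Proof.
move=> d_gt0 Pm nred; under eq_bigr do rewrite scalerBr.
rewrite sumrB mcoeffB mcoeff_bmonomials // raddf_sum big1 ?subr0 // => m' _ /=.
rewrite mcoeffZ mcoeffX; case: eqP nred => [<-|]; last by rewrite mulr0.
by rewrite reduced_reduce_mnm.
Qed.

(** The binomials x^m - x^(m reduced), for non-reduced m of degree k, form a basis; triangularity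
    gives independence. *)
Lemma dimension_vanishing_ideal_Y_Q (F : finFieldType) (K : fieldType)
    (iota : {rmorphism F -> K}) (n : nat) (w : 'I_n.+1 -> nat) (k : nat) :
  (forall i, (0 < w i)%N) -> (w ord0 %| #|F|.-1)%N ->
  dimension (vanishing_ideal iota (Y_Q w iota) `&` graded_part w F k%:Z) =
  #|[pred m : 'X_{1..n.+1 < k.+1} |
      (wdeg w m == k)%N && ~~ reduced (dnum #|F| w) m]|.
Proof.
move=> w_gt0 w0_dvd; set d := dnum #|F| w.
have Q_gt0 := card_finField_pred_gt0 F.
have d_gt0 i : (0 < d i)%N.
  by rewrite divn_gt0 ?gcdn_gt0 ?Q_gt0 // dvdn_leq // dvdn_gcdl.
have dvd_q (j : 'I_n) : (#|F|.-1 %| d (lift ord0 j) * w (lift ord0 j))%N.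
  by rewrite mulnC dvdn_gcd_mul.
have dvd_w0 (j : 'I_n) := dvdn_trans w0_dvd (dvd_q j).
pose P (m : 'X_{1..n.+1 < k.+1}) := (wdeg w m == k)%N && ~~ reduced d m.
pose comb (c : 'X_{1..n.+1 < k.+1} -> F) :=
  \sum_(m | P m) c m *: ('X_[m] - 'X_[reduce_mnm w d m]).
have hom_comb c : graded_part w F k%:Z (comb c).
  apply/graded_partP => m ne_k; rewrite raddf_sum big1 // => m'.
  move=> /andP[/eqP degm' _].
  rewrite /= mcoeffZ mcoeffB !mcoeffX.
  case: eqP => [mE|_]; first by case: ne_k; rewrite -mE degm'.
  case: eqP => [mE|_]; last by rewrite subrr mulr0.
  by case: ne_k; rewrite -mE wdeg_reduce_mnm ?degm'.
have van_comb c t : (forall i, t i != 0) -> (comb c).@[fun i => t i ^+ w i] = 0.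
  move=> t0; rewrite raddf_sum big1 // => m _.
  by rewrite /= mevalZ mevalB meval_reduce_mnm // subrr mulr0.
apply: (dimension_card (b := fun m : 'X_{1..n.+1 < k.+1} =>
          'X_[F, m] - 'X_[F, reduce_mnm w d m])) => [f|c c0 m /andP[degm nred]].
  split=> [/vanishing_ideal_Y_Q_graded[homf vanf]|[c ->]]; last first.
    by apply/vanishing_ideal_Y_Q_graded; split=> [|t];
      [exact: hom_comb|exact: van_comb].
  (* With these coefficients [f - comb c] has only reduced monomials, and as it still vanishes on
     the torus points it is zero. *)
  pose c (m : 'X_{1..n.+1 < k.+1}) := f@_m; exists c.
  apply/eqP; rewrite -subr_eq0 -[X in f - X]/(comb c); apply/eqP.
  have hom_sub : graded_part w F k%:Z (f - comb c).
    apply/graded_partP => m ne_k; rewrite mcoeffB.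
    by rewrite ((graded_partP _ _ _).1 homf)
      ?((graded_partP _ _ _).1 (hom_comb c)) ?subrr.
  apply: (vanishing_reduced_eq0 (w_gt0 ord0) hom_sub); last first.
    by move=> t t0; rewrite mevalB vanf ?van_comb ?subrr.
  move=> m mf; apply/forallP; rewrite -/(reduced d m); move: mf.
  apply: contraTT => nred; rewrite mcoeff_msupp negbK.
  have [degm|/eqP ne_k] := eqVneq (wdeg w m) k; last first.
    by apply/eqP/((graded_partP _ _ _).1 hom_sub) => -[].
  have lt_m : (mdeg m < k.+1)%N by rewrite ltnS -degm mdeg_le_wdeg.
  have -> : (f - comb c)@_m = f@_m - c (BMultinom lt_m); last by rewrite subrr.
  rewrite mcoeffB; congr (_ - _).
  apply: (@mcoeff_reduction_binomials _ w d _ _ P c (BMultinom lt_m)) => //.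
  by rewrite /P /= degm eqxx.
have <- := @mcoeff_reduction_binomials _ w d _ _ P c m d_gt0.
- by rewrite [X in X@_m]c0 mcoeff0.
- by rewrite /P degm.
- by [].
Qed.

(** * Hilbert function, Hilbert numerator and a-invariant *)

Lemma hilbert_fun_Y_Q (F : finFieldType) (K : fieldType)
    (iota : {rmorphism F -> K}) (n : nat) (w : 'I_n.+1 -> nat) (k : nat) :
  (forall i, (0 < w i)%N) -> (w ord0 %| #|F|.-1)%N ->
  hilbert_fun iota (Y_Q w iota) k%:Z =
  #|[pred m : 'X_{1..n.+1 < k.+1} |
      (wdeg w m == k)%N && reduced (dnum #|F| w) m]|%:Z.
Proof.
move=> w_gt0 w0_dvd; rewrite /hilbert_fun dimension_vanishing_ideal_Y_Q //.
have := dimension_graded_part F k 0 w_gt0; rewrite subr0 => ->.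
apply/eqP; rewrite subr_eq -PoszD; apply/eqP; congr Posz.
set d := dnum _ w.
rewrite -!sum1_card (bigID (fun m : 'X_{1..n.+1 < k.+1} => reduced d m)).
by congr addn; apply: eq_bigl => m; rewrite !inE addn0.
Qed.

(* Equivalently, the Hilbert series of the polynomial ring is the inverse of
   [\prod_i (1 - t ^ w_i)]. *)
Lemma sum_dimension_graded_part (F : fieldType) (n : nat)
    (w : 'I_n.+1 -> nat) (k s : nat) :
  (forall i, (0 < w i)%N) ->
  \sum_(A : {set 'I_n.+1}) (-1) ^+ #|A| *
    (dimension (graded_part w F (k%:Z - (s + \sum_(i in A) w i)%N%:Z)))%:Z =
  (k == s)%:R.
Proof.
move=> w_gt0.
(* Inclusion-exclusion with all bounds equal to 1 leaves only the monomial 1, which has degree 0. *)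
transitivity (#|[pred m : 'X_{1..n.+1 < k.+1} |
    (wdeg w m + s == k)%N && [forall j : 'I_n.+1, (m j < 1)%N]]|%:Z).
  rewrite -(inclusion_exclusion_monomials (phi := id) (fun=> 1%N) k s w_gt0) //.
  apply: eq_bigr => A _; rewrite dimension_graded_part //.
  by under [in RHS]eq_bigr do rewrite mul1n.
have eq0 (m : 'X_{1..n.+1}) :
    [forall j : 'I_n.+1, (m j < 1)%N] -> m = 0%MM.
  move=> /forallP m0; apply/mnmP => i; rewrite mnm0E.
  by apply/eqP; rewrite -leqn0 -ltnS.
have wdeg0 : wdeg w 0%MM = 0%N.
  by rewrite /wdeg big1 // => i _; rewrite mnm0E muln0.
have [->|ne_ks] := eqVneq k s.
  have lt0 : (mdeg (0%MM : 'X_{1..n.+1}) < s.+1)%N by rewrite mdeg0.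
  rewrite (eq_card (B := pred1 (BMultinom lt0))) ?card1 // => m.
  rewrite !inE bmeqP /=; apply/andP/eqP => [[_ m0]|m0]; first exact: eq0.
  by rewrite m0 wdeg0; split=> //; apply/forallP => i; rewrite mnm0E.
rewrite eq_card0 // => m; rewrite !inE; apply/andP => -[degm m0].
by move: degm ne_ks; rewrite (eq0 _ m0) wdeg0 add0n eq_sym => ->.
Qed.

(** Inclusion-exclusion over the indices i >= 1 with bounds d_i; the exponent of x_0 stays
    unbounded. *)
Lemma sum_hilbert_Y_Q (F : finFieldType) (K : fieldType)
    (iota : {rmorphism F -> K}) (n : nat) (w : 'I_n.+1 -> nat) (k : nat) :
  (forall i, (0 < w i)%N) -> (w ord0 %| #|F|.-1)%N ->
  hilbert_fun iota (Y_Q w iota) k%:Z =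
  \sum_(I : {set 'I_n}) (-1) ^+ #|I| *
    (dimension (graded_part w F (k%:Z - (alpha_set #|F| w I)%:Z)))%:Z.
Proof.
move=> w_gt0 w0_dvd; rewrite hilbert_fun_Y_Q //.
transitivity (#|[pred m : 'X_{1..n.+1 < k.+1} |
    (wdeg w m + 0 == k)%N && reduced (dnum #|F| w) m]|%:Z).
  by congr Posz; apply: eq_card => m; rewrite !inE addn0.
rewrite -(inclusion_exclusion_monomials (phi := lift ord0)
  (fun j => dnum #|F| w (lift ord0 j)) k 0 w_gt0 lift_inj).
by apply: eq_bigr => A _; rewrite dimension_graded_part // add0n.
Qed.

(** Each dimension in the alternating formula contributes a shifted copy of the Hilbert series of
    the polynomial ring; multiplying by the denominator turns the copy shifted by alpha_I into
    t^(alpha_I). *)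
Lemma is_hilbert_numerator_Y_Q (F : finFieldType) (K : fieldType)
    (iota : {rmorphism F -> K}) (n : nat) (w : 'I_n.+1 -> nat) :
  (forall i, (0 < w i)%N) -> (w ord0 %| #|F|.-1)%N ->
  is_hilbert_numerator iota (Y_Q w iota)
    (\prod_(i < n)
       (1 - 'X^(dnum #|F| w (lift ord0 i) * w (lift ord0 i))%N)).
Proof.
move=> w_gt0 w0_dvd k; rewrite !prodr_1BXn.
pose D s := (dimension (graded_part w F (k%:Z - s%:Z)))%:Z.
(* Truncating the convolution at j <= k thus loses nothing. *)
have D_eq0 s : (k < s)%N -> D s = 0.
  move=> lt_ks; rewrite /D dimension_graded_part // eq_card0 // => m.
  by rewrite !inE; apply/eqP => degm; move: lt_ks; rewrite -degm ltnNge leq_addl.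
have sum_delta (a b : nat) :
    \sum_(j < k.+1) (j == a :> nat)%:R * D (j + b)%N = D (a + b)%N.
  have [lt_ak|le_ka] := ltnP a k.+1.
    rewrite (bigD1 (Ordinal lt_ak)) //= eqxx mul1r big1 ?addr0 // => j.
    by rewrite -val_eqE /= => /negPf ->; rewrite mul0r.
  rewrite D_eq0 ?(leq_trans le_ka) ?leq_addr // big1 // => j _.
  by rewrite ltn_eqF ?mul0r // (leq_trans (ltn_ord j)).
have coefXE (J : finType) (a : J -> nat) j :
    (\sum_(A : {set J}) (-1) ^+ #|A| *: 'X^(\sum_(j in A) a j)%N : {poly int})`_j
    = \sum_(A : {set J}) (-1) ^+ #|A| * (j == \sum_(j in A) a j)%N%:R.
  by rewrite coef_sum; apply: eq_bigr => A _; rewrite coefZ coefXn.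
rewrite coefXE.
transitivity (\sum_(j < k.+1) \sum_(A : {set 'I_n.+1}) \sum_(I : {set 'I_n})
    (-1) ^+ #|I| * ((-1) ^+ #|A| *
      ((j == \sum_(i in A) w i :> nat)%N%:R *
        D (j + alpha_set #|F| w I)%N))); last first.
  apply: eq_bigr => j _; rewrite coefXE mulr_suml; apply: eq_bigr => A _.
  rewrite sum_hilbert_Y_Q // mulr_sumr; apply: eq_bigr => I _.
  rewrite [RHS]mulrCA -mulrA.
  congr (_ * (_ * (_ * (dimension (graded_part _ _ _))%:Z))).
  by rewrite -subzn ?PoszD ?opprD ?addrA // -ltnS.
rewrite exchange_big /=; under [RHS]eq_bigr do rewrite exchange_big /=.
rewrite exchange_big /=; apply: eq_bigr => I _.
(* For fixed I the sum over A is 1 if k = alpha_I and 0 otherwise. *)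
rewrite -(sum_dimension_graded_part F k _ w_gt0) mulr_sumr; apply: eq_bigr => A _.
by rewrite -!mulr_sumr sum_delta /D addnC.
Qed.

Lemma hilbert_numerator_unique (F K : fieldType) (iota : {rmorphism F -> K})
    (n : nat) (w : 'I_n.+1 -> nat) (Y : set (wproj w K)) (p : {poly int}) :
  is_hilbert_numerator iota Y p -> hilbert_numerator iota Y = p.
Proof.
move=> Yp; apply: xget_unique => // p' Yp'.
by apply/polyP => k; rewrite Yp Yp'.
Qed.

Lemma size_prodr_1BXn (R : idomainType) (J : finType) (a : J -> nat) :
  (forall j, (0 < a j)%N) ->
  size (\prod_j (1 - 'X^(a j) : {poly R})) = (\sum_j a j).+1.
Proof.
move=> a_gt0.
have sizeE j : size (1 - 'X^(a j) : {poly R}) = (a j).+1.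
  by rewrite addrC size_polyDl size_polyN size_polyXn // size_poly1 ltnS.
rewrite size_prod => [|j _]; last by rewrite -size_poly_eq0 sizeE.
under eq_bigr do rewrite sizeE -addn1.
by rewrite big_split sum1_card -addSn addnK.
Qed.

Theorem proposition3p4
    (F : finFieldType)
    (K : closedFieldType) (iota : {rmorphism F -> K})
    (iota_int : integralRange iota)
    (n : nat) (n_ge1 : (1 <= n)%N)
    (w : 'I_n.+1 -> nat) (w_gt0 : forall i, (0 < w i)%N)
    (w_wf : well_formed w)
    (w0_dvd : (w ord0 %| #|F|.-1)%N) :
  (forall alpha : nat, in_semigroup w alpha ->
     hilbert_fun iota (Y_Q w iota) alpha%:Z =
       \sum_(s < n.+1) (-1) ^+ s *
         \sum_(I : {set 'I_n} | #|I| == s)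
            (dimension (graded_part w F (alpha%:Z - (alpha_set #|F| w I)%:Z)))%:Z)
  /\
  a_invariant iota (Y_Q w iota) =
    \sum_(i < n) ((dnum #|F| w (lift ord0 i))%:Z - 1) * (w (lift ord0 i))%:Z
    - (w ord0)%:Z.
Proof.
split=> [alpha _|].
  rewrite sum_hilbert_Y_Q //.
  have card_lt (I : {set 'I_n}) : (#|I| < n.+1)%N.
    by rewrite ltnS -[X in (_ <= X)%N]card_ord max_card.
  (* Subsets are grouped by cardinality, which is at most n. *)
  rewrite (partition_big (fun I : {set 'I_n} => Ordinal (card_lt I)) predT) //=.
  apply: eq_bigr => s _; rewrite mulr_sumr; apply: eq_big => [I|I /eqP <- //].
  by rewrite -val_eqE.
rewrite /a_invariant
  (hilbert_numerator_unique (is_hilbert_numerator_Y_Q iota w_gt0 w0_dvd)).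
(* Every d_i is positive because gcd(q - 1, w_i) divides q - 1 > 0, so the numerator has degree the
   sum of the d_i w_i. *)
rewrite size_prodr_1BXn => [|j] /=; last first.
  rewrite muln_gt0 w_gt0 andbT divn_gt0 ?gcdn_gt0 ?card_finField_pred_gt0 //.
  by rewrite dvdn_leq ?card_finField_pred_gt0 // dvdn_gcdl.
rewrite big_ord_recl opprD addrCA addrC; congr (_ - _).
rewrite -natz natr_sum -sumrB; apply: eq_bigr => i _.
by rewrite natz PoszM mulrBl mul1r.
Qed.
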